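(* For any $0<\epsilon<1$, there cannot exist any deterministic (or possibly randomized) algorithm for $\min_{X\subseteq V}[f(X)-g(X)]$, where $f$ and $g$ are given submodular functions on a ground set $V$ with $|V|=n$, that always finds a solution which is at most $\frac{1}{\epsilon}$ times the optimal, in fewer than $e^{\epsilon^2 n/8}$ queries.
   Context: A set function $f:2^V\to\mathbb{R}$ on a finite ground set $V=\{1,\dots,n\}$ is submodular if $f(S)+f(T)\ge f(S\cup T)+f(S\cap T)$ for all $S,T\subseteq V$. The optimal value is $\min_{X\subseteq V}[f(X)-g(X)]$, and a solution is a set $X'\subseteq V$ with value $f(X')-g(X')$. Queries are function evaluations at subsets of $V$. The result is an information-theoretic hardness statement, independent of whether $\mathrm{P}=\mathrm{NP}$. *)

(* Defs.v *)
From HB Require Import structures.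
From mathcomp Require Import all_boot all_order all_algebra.
From mathcomp Require Import all_classical all_reals all_analysis.

Set Implicit Arguments.
Unset Strict Implicit.
Unset Printing Implicit Defensive.

Import Order.TTheory GRing.Theory Num.Theory.

Local Open Scope ring_scope.

Definition submodular (R : realType) (n : nat) (f : {set 'I_n} -> R) : Prop :=
  forall S T : {set 'I_n}, f (S :|: T) + f (S :&: T) <= f S + f T.

(* The default [v finset.set0] is itself one of the values of [v], so this is
   the minimum of [v] over all subsets. *)
Definition opt (R : realType) (n : nat) (v : {set 'I_n} -> R) : R :=
  \big[Order.min/v finset.set0]_(X : {set 'I_n}) v X.

(* A deterministic algorithm with oracle access to f and g, of unbounded
   computational power: an adaptive decision tree. [Query S k] asks for the
   values at S and continues with [k (f S) (g S)]. Such a query reveals both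
   values at unit cost; an algorithm that pays separately for f S and g S, or
   that only sees f S - g S, is a special case making no more queries here. *)
Inductive algorithm (R : realType) (n : nat) : Type :=
| Output of {set 'I_n}
| Query of {set 'I_n} & (R -> R -> algorithm R n).

Arguments Output {R n} _.
Arguments Query {R n} _ _.

Fixpoint output (R : realType) (n : nat) (f g : {set 'I_n} -> R)
    (A : algorithm R n) : {set 'I_n} :=
  match A with
  | Output X => X
  | Query Y k => output f g (k (f Y) (g Y))
  end.

Fixpoint queries (R : realType) (n : nat) (f g : {set 'I_n} -> R)
    (A : algorithm R n) : nat :=
  match A with
  | Output _ => 0
  | Query Y k => (queries f g (k (f Y) (g Y))).+1
  end.

Definition approximates (R : realType) (n : nat) (eps : R)
    (f g : {set 'I_n} -> R) (A : algorithm R n) : Prop :=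
  let X := output f g A in
  f X - g X <= eps^-1 * opt (fun Y => f Y - g Y).

Definition few_queries (R : realType) (n : nat) (eps : R)
    (f g : {set 'I_n} -> R) (A : algorithm R n) : Prop :=
  (queries f g A)%:R < expR (eps ^+ 2 * n%:R / 8).

(* A multiplicative guarantee is only meaningful when the optimum is positive:
   if it is negative, eps^-1 times the optimum is below the optimum and no set
   meets the guarantee. Algorithms are only held to account on instances with
   positive optimum; requiring more of them would make the impossibility
   weaker (indeed trivial). *)
Definition positive_instance (R : realType) (n : nat)
    (f g : {set 'I_n} -> R) : Prop :=
  [/\ submodular f, submodular g & 0 < opt (fun X => f X - g X)].

(* Main.v *)
Require Import Defs.
From HB Require Import structures.
From mathcomp Require Import all_boot all_order all_algebra.
From mathcomp Require Import all_classical all_reals all_analysis.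
From mathcomp Require Import ring lra.

Set Implicit Arguments.
Unset Strict Implicit.
Unset Printing Implicit Defensive.

Import Order.TTheory GRing.Theory Num.Theory.

Local Open Scope ring_scope.

(** Every set function v with values in [0, K] is a difference of submodular
    functions f - g with f S = v S - K |S|^2 and g S = - K |S|^2, so the oracle
    reveals nothing but values of v.  Run the algorithm on v = 1 constantly: as
    exp (eps^2 n / 8) <= 2^n, some sets stay unqueried.  If the output was
    queried, hide the value eps / 2 at an unqueried set; otherwise put the value
    2 / eps at the output.  Either change leaves the run unaffected and breaks
    the guarantee.  Since n and eps determine finitely many such instances, a
    randomized algorithm that succeeds almost surely on each of them has an
    outcome that succeeds on all of them, and that outcome is a deterministic
    algorithm. *)

Fixpoint queried (R : realType) (n : nat) (f g : {set 'I_n} -> R)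
    (A : algorithm R n) : seq {set 'I_n} :=
  match A with
  | Output _ => [::]
  | Query Y k => Y :: queried f g (k (f Y) (g Y))
  end.

Lemma size_queried (R : realType) (n : nat) (f g : {set 'I_n} -> R)
    (A : algorithm R n) : size (queried f g A) = queries f g A.
Proof. by elim: A => //= Y k ->. Qed.

Lemma eq_output (R : realType) (n : nat) (f f' g : {set 'I_n} -> R)
    (A : algorithm R n) :
  {in queried f g A, f =1 f'} -> output f' g A = output f g A.
Proof.
elim: A => //= Y k IHk eq_ff'; rewrite -eq_ff' ?mem_head//.
by apply: IHk => X QX; apply: eq_ff'; rewrite in_cons QX orbT.
Qed.

Definition concave_shift (R : realType) (n : nat) (K : R)
    (v : {set 'I_n} -> R) (S : {set 'I_n}) : R := v S - K * #|S|%:R ^+ 2.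

(** For comparable [S] and [T] both sides agree. Otherwise [p = #|S :\: T|] and [r = #|T :\: S|] are
    at least 1, and the quadratic term gains [2 * K * p * r >= 2 * K], which pays for the values of
    [v] at the union and the intersection. *)
Lemma concave_shift_submodular (R : realType) (n : nat) (K : R)
    (v : {set 'I_n} -> R) :
  (forall S, 0 <= v S <= K) -> submodular (concave_shift K v).
Proof.
move=> v_bnd S T; rewrite /concave_shift.
have [sST|nsST] := boolP (S \subset T).
  by rewrite (finset.setUidPr sST) (finset.setIidPl sST) addrC.
have [sTS|nsTS] := boolP (T \subset S).
  by rewrite (finset.setUidPl sTS) (finset.setIidPr sTS).
have [p1 r1] : (0 < #|S :\: T|)%N /\ (0 < #|T :\: S|)%N.
  by rewrite !card_gt0 !finset.setD_eq0.
have eU : #|S :|: T| = (#|S :&: T| + #|S :\: T| + #|T :\: S|)%N.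
  apply/eqP; rewrite -(eqn_add2r #|S :&: T|) cardsUI cardsID.
  by rewrite -(cardsID S T) finset.setIC addnAC addnA.
rewrite eU -(cardsID T S) -(cardsID S T) [T :&: S]finset.setIC !natrD.
move: p1 r1; rewrite -(ler_nat R) -(ler_nat R 1).
set i : R := #|S :&: T|%:R; set p : R := #|S :\: T|%:R.
set r : R := #|T :\: S|%:R => p1 r1.
have /andP[US0 USK] := v_bnd (S :|: T); have /andP[IS0 ISK] := v_bnd (S :&: T).
have /andP[S0 _] := v_bnd S; have /andP[T0 _] := v_bnd T.
have pr1 : 1 <= p * r by rewrite -[1]mulr1 ler_pM.
(* [K] is nonnegative because it bounds a nonnegative value of [v]. *)
have KKpr : K <= K * (p * r) by rewrite ler_peMr// (le_trans US0).
nra.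
Qed.

Lemma concave_shiftB (R : realType) (n : nat) (K : R) (v : {set 'I_n} -> R) :
  (fun S => concave_shift K v S - concave_shift K (fun=> 0) S) = v.
Proof. by apply/funext => S; rewrite /concave_shift; ring. Qed.

Definition spike (R : realType) (n : nat) (T : {set 'I_n}) (c : R)
    (S : {set 'I_n}) : R := if S == T then c else 1.

Lemma exists_notin_seq (T : finType) (s : seq T) :
  (size s < #|T|)%N -> exists x, x \notin s.
Proof.
rewrite ltnNge => lt_sT; apply/existsP; apply: contraNT lt_sT.
rewrite negb_exists cardE => /forallP sT; rewrite uniq_leq_size ?enum_uniq//.
by move=> x _; move: (sT x); rewrite negbK.
Qed.

(** Taking [n]-th roots leaves [expR x <= 2] for [x = eps ^+ 2 / 8 < 1 / 8], which follows from
    [expR (- x) >= 1 - x >= 1 / 2]. *)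
Lemma expR_eps_le_exp2 (R : realType) (n : nat) (eps : R) :
  0 < eps -> eps < 1 -> expR (eps ^+ 2 * n%:R / 8) <= 2 ^+ n.
Proof.
move=> eps0 eps1.
have -> : eps ^+ 2 * n%:R / 8 = n%:R * (eps ^+ 2 / 8) by ring.
rewrite expRM_natl lerXn2r ?nnegrE ?expR_ge0//.
have := expR_ge1Dx (- (eps ^+ 2 / 8)); rewrite expRN => lb.
have {}lb : 2^-1 <= (expR (eps ^+ 2 / 8))^-1 by apply: le_trans lb; nra.
by rewrite -(lef_pV2 _ _) ?posrE ?expR_gt0.
Qed.

Definition succeeds (R : realType) (n : nat) (eps : R) (A : algorithm R n)
    (f g : {set 'I_n} -> R) : Prop :=
  approximates eps f g A /\ few_queries eps f g A.

(** The shift [2 / eps] is the largest spike height used, so one [g] serves all instances and only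
    [f] varies. *)
Definition spike_f (R : realType) (n : nat) (eps c : R) (T : {set 'I_n}) :=
  concave_shift (2 / eps) (spike T c).

Definition spike_g (R : realType) (n : nat) (eps : R) : {set 'I_n} -> R :=
  concave_shift (2 / eps) (fun=> 0).

Lemma spike_positive (R : realType) (n : nat) (eps c : R) (T : {set 'I_n}) :
  0 < eps -> eps < 1 -> 0 < c -> c <= 2 / eps ->
  positive_instance (spike_f eps c T) (@spike_g R n eps).
Proof.
move=> eps0 eps1 c0 cK.
have K1 : 1 <= 2 / eps by rewrite ler_pdivlMr//; lra.
have sp0 S : 0 < spike T c S by rewrite /spike; case: ifP.
split.
- apply: concave_shift_submodular => S; rewrite ltW//=.
  by rewrite /spike; case: ifP.
- by apply: concave_shift_submodular => S; rewrite lexx/= (le_trans _ K1).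
- by rewrite concave_shiftB /opt; apply: lt_bigmin.
Qed.

Lemma no_algorithm_on_spikes (R : realType) (n : nat) (eps : R)
    (A : algorithm R n) :
  (0 < n)%N -> 0 < eps -> eps < 1 ->
  (forall T, succeeds eps A (spike_f eps 1 T) (spike_g eps)) ->
  (forall T, succeeds eps A (spike_f eps (eps / 2) T) (spike_g eps)) ->
  (forall T, succeeds eps A (spike_f eps (2 / eps) T) (spike_g eps)) -> False.
Proof.
move=> n0 eps0 eps1 flat low high.
pose f1 := @spike_f R n eps 1 finset.set0; pose g := @spike_g R n eps.
pose X := output f1 g A; pose Q := queried f1 g A.
have cardP : #|{: {set 'I_n}}| = (2 ^ n)%N.
  by rewrite -cardsT -powersetT card_powerset cardsT card_ord.
(* A spike of height 1 is invisible, so its position [set0] is arbitrary. *)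
have flat1 : spike finset.set0 1 =1 (fun=> 1) :> ({set 'I_n} -> R).
  by move=> S; rewrite /spike; case: ifP.
have sameX c T : T \notin Q -> output (spike_f eps c T) g A = X.
  move=> QT; apply: eq_output => S QS; rewrite /f1 /spike_f /concave_shift.
  by rewrite flat1 /spike; case: eqP => // eST; rewrite -eST QS in QT.
have bound c T : T \notin Q ->
    succeeds eps A (spike_f eps c T) g -> forall S,
    spike T c X <= eps^-1 * spike T c S.
  move=> QT [+ _] S; rewrite /approximates sameX// concave_shiftB => apx.
  have <- : spike_f eps c T X - g X = spike T c X.
    by rewrite -[RHS](congr1 (@^~ X) (concave_shiftB (2 / eps) (spike T c))).
  by rewrite (le_trans apx)// ler_pM2l ?invr_gt0// bigmin_le.
have [QX|QX] := boolP (X \in Q).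
- have [T QT] : exists T, T \notin Q.
    apply: exists_notin_seq; rewrite cardP size_queried.
    rewrite -(ltr_nat R) natrX (lt_le_trans _ (expR_eps_le_exp2 n eps0 eps1))//.
    by case: (flat finset.set0).
  (* Since [X] differs from [T], the guarantee would read [1 <= eps^-1 * (eps / 2)]. *)
  have := bound _ _ QT (low T) T; rewrite /spike eqxx.
  case: eqP => [eXT|_]; first by rewrite -eXT QX in QT.
  by rewrite mulrA mulVf ?gt_eqF//; lra.
(* A second set exists because [0 < n]; its value 1 would force [2 / eps <= eps^-1]. *)
- have [T neTX] : exists T : {set 'I_n}, T \notin [:: X].
    by apply: exists_notin_seq; rewrite cardP (@ltn_exp2l 2 0).
  move: neTX; rewrite inE => /negPf neTX.
  have := bound _ _ QX (high X) T; rewrite /spike eqxx neTX mulr1.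
  by rewrite ler_pdivrMr// mulVf ?gt_eqF//; lra.
Qed.

Theorem theorem5p2 (R : realType) (n : nat) (eps : R)
    (hn : (0 < n)%N) (heps0 : 0 < eps) (heps1 : eps < 1) :
  (~ exists A : algorithm R n,
       forall f g : {set 'I_n} -> R, positive_instance f g ->
         approximates eps f g A /\ few_queries eps f g A)
  /\
  (forall (d : measure_display) (Omega : measurableType d)
          (P : probability Omega R),
     ~ exists A : Omega -> algorithm R n,
         forall f g : {set 'I_n} -> R, positive_instance f g ->
           {ae P, forall w : Omega,
              approximates eps f g (A w) /\ few_queries eps f g (A w)}).
Proof.
have K1 : 1 <= 2 / eps by rewrite ler_pdivlMr//; lra.
have low0 : 0 < eps / 2 by rewrite divr_gt0.
have lowK : eps / 2 <= 2 / eps by apply: le_trans K1; lra.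
have high0 : 0 < 2 / eps by rewrite divr_gt0.
split=> [[A goodA]|d Omega P [A goodA]].
  by apply: (@no_algorithm_on_spikes R n eps A) => // T;
     apply: goodA; apply: spike_positive.
(* Positive total mass makes the almost-everywhere filter proper, so a property holding almost
   surely holds at some outcome. *)
have PT0 : (0 < P setT)%E by rewrite probability_setT.
have ae_proper := ae_properfilter_algebraOfSetsType PT0.
have good c : 0 < c -> c <= 2 / eps -> \forall w \near almost_everywhere P,
    forall T, succeeds eps (A w) (spike_f eps c T) (spike_g eps).
  (* The null set may depend on the instance, but [T] ranges over a finite type. *)
  by move=> c0 cK; apply: filter_forall => T; apply/goodA/spike_positive.
have [w [flat [low high]]] := filter_ex (filterI (good 1 ltr01 K1)
  (filterI (good _ low0 lowK) (good _ high0 (lexx _)))).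
exact: no_algorithm_on_spikes flat low high.
Qed.
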